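(* Let $1<p\le\infty$, $1\le q\le\infty$ and $k\ge1$. The $(p,q)$-Wasserstein distance for $k$-th graded persistence diagrams does not satisfy the triangle inequality; that is, there exist tame persistence modules indexed by $\mathbb{R}$ whose $k$-th graded persistence diagrams $D_k,E_k,F_k:\mathbb{R}^2_<\to\mathbb{Z}$ satisfy $$W_{p,q}(D_k,F_k)>W_{p,q}(D_k,E_k)+W_{p,q}(E_k,F_k).$$
   Context: Tame persistence modules. Let $\mathbb{F}$ be a field and $[m]=\{0<1<\dots<m\}$. A persistence module indexed by a sub-poset $P$ of $(\mathbb{R},\le)$ is a functor from $P$ to finite-dimensional $\mathbb{F}$-vector spaces. Given $M$ indexed by $[m]$, extend it to $\hat M$ indexed by $[m+1]$ by $\hat M(m+1)=0$. Given an injective order-preserving $\iota:[m+1]\to\mathbb{R}$, $\overline{M}$ is the persistence module indexed by $\mathbb{R}$ with $\overline{M}(a)=\hat M(i)$, where $i$ is the largest element of $[m+1]$ with $\iota(i)\le a$, and $\overline{M}(a)=0$ if $a<\iota(0)$, with induced structure maps. A persistence module indexed by $\mathbb{R}$ is tame if it is isomorphic to some $\overline{M}$ (for some $m$, $M$, $\iota$). Graded persistence diagrams. For a poset $P$, $P^2_<$ is the poset of half-open intervals $[a,b)$, $a<b$ in $P$, ordered by inclusion. For $[a,b)\in[m+1]^2_<$ let $\operatorname{Rank}_k(M)[a,b)=1$ if $\operatorname{rank}M(a\le b-1)\ge k$ and $0$ otherwise. Let $\mu$ be the Möbius function of $[m+1]^2_<$ ($\mu[x,x]=1$, $\mu[x,y]=-\sum_{x\le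 y'<y}\mu[x,y']$ for $x<y$), and $\operatorname{PD}_k(M)(x)=\sum_{x\le x'}\mu[x,x']\operatorname{Rank}_k(M)(x')$. The $k$-th graded persistence diagram of $\overline{M}$ is the function $\mathbb{R}^2_<\to\mathbb{Z}$ whose value at $[\iota(x),\iota(y))$ is $\operatorname{PD}_k(M)[x,y)$ and which is $0$ elsewhere. Wasserstein distance. Identify $[x,y)\in\mathbb{R}^2_<$ with the point $(x,y)\in\mathbb{R}^2$ and let $\Delta=\{(x,x):x\in\mathbb{R}\}$. For finitely supported $D,E:\mathbb{R}^2_<\to\mathbb{Z}_{\ge0}$, a coupling is a map $\gamma:(\mathbb{R}^2_<\cup\Delta)\times(\mathbb{R}^2_<\cup\Delta)\to\mathbb{Z}_{\ge0}$ with $\gamma=0$ on $\Delta\times\Delta$, $D(z)=\sum_{w\in\mathbb{R}^2_<\cup\Delta}\gamma(z,w)$ for all $z\in\mathbb{R}^2_<$, and $E(w)=\sum_{z\in\mathbb{R}^2_<\cup\Delta}\gamma(z,w)$ for all $w\in\mathbb{R}^2_<$. Viewing $\gamma$ as a finite multiset of pairs, its $(p,q)$-cost is the $p$-norm of the vector with entries $\|w-z\|_q$ for $(z,w)\in\gamma$ (with multiplicity). $W_{p,q}(D,E)$ is the infimum of the $(p,q)$-costs over all couplings. For finitely supported $A,B:\mathbb{R}^2_<\to\mathbb{Z}$, writing $A=A^+-A^-$, $B=B^+-B^-$ with $A^\pm,B^\pm\ge0$ and $A^+,A^-$ (resp. $B^+,B^-$) of disjoint support, $W_{p,q}(A,B):=W_{p,q}(A^++B^-,\,B^++A^-)$.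 *)

(* Defs.v *)
From HB Require Import structures.
From mathcomp Require Import all_boot all_order all_algebra.
From mathcomp Require Import finmap.
From mathcomp Require Import all_classical all_reals.
From mathcomp Require Import ereal normedtype exp.

Set Implicit Arguments.
Unset Strict Implicit.
Unset Printing Implicit Defensive.

Import Order.TTheory GRing.Theory Num.Theory.

Local Open Scope ring_scope.

Record pmodule (K : fieldType) (d : Order.disp_t) (P : porderType d) := PModule {
  pm_obj :> P -> vectType K;
  pm_map : forall a b : P, (a <= b)%O -> 'Hom(pm_obj a, pm_obj b);
  pm_map_id : forall (a : P) (h : (a <= a)%O), pm_map h = \1%VF;
  pm_map_comp : forall (a b c : P) (hab : (a <= b)%O) (hbc : (b <= c)%O)
      (hac : (a <= c)%O),
    (pm_map hbc \o pm_map hab)%VF = pm_map hac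
}.

Definition pm_iso (K : fieldType) (d : Order.disp_t) (P : porderType d)
    (M N : pmodule K P) : Prop :=
  exists (f : forall a : P, 'Hom(M a, N a)) (g : forall a : P, 'Hom(N a, M a)),
    [/\ forall a, (g a \o f a)%VF = \1%VF,
        forall a, (f a \o g a)%VF = \1%VF &
        forall (a b : P) (h : (a <= b)%O),
          (f b \o pm_map M h)%VF = (pm_map N h \o f a)%VF].

(* Pulling back along a partial map [f : Q -> option P], with value the zero
   space where [f] is undefined.  This is functorial because [f] is monotone
   and its domain is convex. *)
Section Pull.
Variables (K : fieldType) (d d' : Order.disp_t).
Variables (P : porderType d) (Q : porderType d') (N : pmodule K P).
Variable f : Q -> option P.
Hypothesis f_mono : forall a b i j,
  (a <= b)%O -> f a = Some i -> f b = Some j -> (i <= j)%O.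
Hypothesis f_conv : forall a b c,
  (a <= b)%O -> (b <= c)%O -> f a -> f c -> f b.

Definition oobj (o : option P) : vectType K :=
  if o is Some i then N i else 'rV[K]_0.

Definition ole (o o' : option P) : Prop :=
  forall i j, o = Some i -> o' = Some j -> (i <= j)%O.

Definition pull_map (o o' : option P) : ole o o' -> 'Hom(oobj o, oobj o') :=
  match o, o' return ole o o' -> 'Hom(oobj o, oobj o') with
  | Some i, Some j => fun h => pm_map N (h i j erefl erefl)
  | _, _ => fun _ => 0
  end.

Lemma pull_ole (a b : Q) : (a <= b)%O -> ole (f a) (f b).
Proof. by move=> ab i j; apply: f_mono. Qed.

Lemma pull_map_id (o : option P) (h : ole o o) : pull_map h = \1%VF.
Proof.
case: o h => [i|] h /=; first exact: pm_map_id.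
by apply/lfunP => v; rewrite !lfunE [v]thinmx0 [RHS]thinmx0.
Qed.

Lemma pull_map_comp (o1 o2 o3 : option P) (h12 : ole o1 o2) (h23 : ole o2 o3)
    (h13 : ole o1 o3) :
  (o1 -> o3 -> o2) -> (pull_map h23 \o pull_map h12)%VF = pull_map h13.
Proof.
case: o1 h12 h13 => [i|]; case: o2 h23 => [j|]; case: o3 => [l|] //=
  h23 h12 h13 conv; rewrite ?comp_lfun0l ?comp_lfun0r //.
- exact: pm_map_comp.
- by have := conv isT isT.
Qed.

Definition pull : pmodule K Q.
Proof.
refine (@PModule K d' Q (fun a => oobj (f a))
  (fun a b ab => pull_map (pull_ole ab)) _ _).
- by move=> a h; apply: pull_map_id.
- by move=> a b c ab bc ac; apply: pull_map_comp; apply: f_conv.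
Defined.

End Pull.

Section Hat.
Variables (K : fieldType) (m : nat) (M : pmodule K 'I_m.+1).

Definition hat_idx (i : 'I_m.+2) : option 'I_m.+1 := unlift ord_max i.

Lemma hat_idxE (i : 'I_m.+2) (j : 'I_m.+1) :
  hat_idx i = Some j -> i = j :> nat.
Proof. by rewrite /hat_idx; case: unliftP => // l -> [<-]; rewrite lift_max. Qed.

Lemma hat_mono (a b : 'I_m.+2) (i j : 'I_m.+1) :
  (a <= b)%O -> hat_idx a = Some i -> hat_idx b = Some j -> (i <= j)%O.
Proof. by rewrite !leEord => ab /hat_idxE <- /hat_idxE <-. Qed.

Lemma hat_conv (a b c : 'I_m.+2) :
  (a <= b)%O -> (b <= c)%O -> hat_idx a -> hat_idx c -> hat_idx b.
Proof.
rewrite !leEord => _ bc _; case hc : (hat_idx c) => [l|//] _.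
rewrite /hat_idx; case: unliftP => // bmax; move: bc.
by rewrite (hat_idxE hc) bmax leqNgt ltn_ord.
Qed.

Definition hat : pmodule K 'I_m.+2 := pull M hat_mono hat_conv.

End Hat.

Record embedding (R : realType) (m : nat) := Embedding {
  emb_fun :> 'I_m.+2 -> R;
  emb_inj : injective emb_fun;
  emb_le : forall i j : 'I_m.+2, (i <= j)%O -> emb_fun i <= emb_fun j
}.

Section Bar.
Variables (K : fieldType) (R : realType) (m : nat).
Variables (M : pmodule K 'I_m.+1) (iota : embedding R m).

Definition bar_idx (a : R) : option 'I_m.+2 :=
  [pick i : 'I_m.+2 | (iota i <= a) &&
                      [forall j : 'I_m.+2, (iota j <= a) ==> (j <= i)%O]].

Lemma bar_mono (a b : R) (i j : 'I_m.+2) :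
  (a <= b)%O -> bar_idx a = Some i -> bar_idx b = Some j -> (i <= j)%O.
Proof.
rewrite /bar_idx; case: pickP => // i' /andP[ia _] ab [<-].
case: pickP => // j' /andP[_ /forallP jmax] [<-].
by have /implyP := jmax i'; apply; apply: le_trans ia ab.
Qed.

Lemma bar_conv (a b c : R) :
  (a <= b)%O -> (b <= c)%O -> bar_idx a -> bar_idx c -> bar_idx b.
Proof.
move=> ab _ + _; rewrite {1}/bar_idx; case: pickP => // i /andP[ia _] _.
have ib : iota i <= b by apply: le_trans ia ab.
case: (@arg_maxnP 'I_m.+2 i (fun j => iota j <= b) val ib) => j jb jmax.
rewrite /bar_idx; case: pickP => // /(_ j) /negbT /negP[].
by apply/andP; split => //; apply/forallP => l; apply/implyP => /jmax.
Qed.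

Definition bar : pmodule K R := pull (hat M) bar_mono bar_conv.

End Bar.

Definition tame (K : fieldType) (R : realType) (N : pmodule K R) : Prop :=
  exists (m : nat) (M : pmodule K 'I_m.+1) (iota : embedding R m),
    pm_iso N (bar M iota).

(* [hoint P] is the poset P^2_< of half-open intervals [a, b[ with a < b,
   ordered by the inclusion order of the library's [interval P]. *)
Record hoint (d : Order.disp_t) (P : porderType d) := HoInt {
  ho_pair : P * P;
  ho_pairP : (ho_pair.1 < ho_pair.2)%O
}.
HB.instance Definition _ (d : Order.disp_t) (P : porderType d) :=
  [isSub for @ho_pair d P].
HB.instance Definition _ (d : Order.disp_t) (P : porderType d) :=
  [Choice of hoint P by <:].

Fact ho_display : Order.disp_t. Proof. exact. Qed.

Section HalfOpen.
Variables (d : Order.disp_t) (P : porderType d).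

Definition ho_lo (x : hoint P) : P := (ho_pair x).1.
Definition ho_hi (x : hoint P) : P := (ho_pair x).2.

Definition ho_itv (x : hoint P) : interval P := `[ho_lo x, ho_hi x[.

Definition ho_le (x y : hoint P) : bool := (ho_itv x <= ho_itv y)%O.

Lemma ho_le_refl : reflexive ho_le.
Proof. by move=> x; apply: lexx. Qed.

Lemma ho_le_anti : antisymmetric ho_le.
Proof.
move=> [[a b] ?] [[a' b'] ?] h; apply: val_inj => /=.
by have := le_anti h; rewrite /ho_itv /ho_lo /ho_hi /= => -[-> ->].
Qed.

Lemma ho_le_trans : transitive ho_le.
Proof. by move=> y x z; apply: le_trans. Qed.

End HalfOpen.

HB.instance Definition _ (d : Order.disp_t) (P : porderType d) :=
  Order.Le_isPOrder.Build ho_display (hoint P)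
    (@ho_le_refl d P) (@ho_le_anti d P) (@ho_le_trans d P).
HB.instance Definition _ (d : Order.disp_t) (P : finPOrderType d) :=
  [Finite of hoint P by <:].

Section Moebius.
Variables (d : Order.disp_t) (T : finPOrderType d).

(* The recursion is bounded by a fuel argument; [moebius_lt] shows that #|T|
   is enough for the usual recursion to hold. *)
Fixpoint moebius_fuel (n : nat) (x y : T) : int :=
  if n is n'.+1 then
    if x == y then 1
    else if (x < y)%O then - \sum_(z : T | (x <= z < y)%O) moebius_fuel n' x z
    else 0
  else 0.

Definition moebius (x y : T) : int := moebius_fuel #|T| x y.

Lemma moebius_fuel_stable (n n' : nat) (x y : T) :
  (#|[set z | z < y]%O| < n)%N -> (#|[set z | z < y]%O| < n')%N ->
  moebius_fuel n x y = moebius_fuel n' x y.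
Proof.
elim: n n' y => [|n IH] [|n'] y //= hn hn'.
case: eqVneq => // _; case: ifP => // _; congr (- _).
apply: eq_bigr => z /andP[_ zy].
have lt : (#|[set w | w < z]%O| < #|[set w | w < y]%O|)%N.
  apply: proper_card; apply/fintype.properP; split.
    by apply/fintype.subsetP => w; rewrite !inE => /lt_trans; apply.
  by exists z; rewrite !inE ?ltxx.
by apply: IH; [apply: leq_trans lt hn|apply: leq_trans lt hn'].
Qed.

Lemma card_below (y : T) : (#|[set z | z < y]%O| < #|T|)%N.
Proof.
rewrite -cardsT; apply: proper_card; apply/fintype.properP; split.
  exact: finset.subsetT.
by exists y; rewrite !inE ?ltxx.
Qed.

Lemma moebius_id (x : T) : moebius x x = 1.
Proof.
rewrite /moebius; have := card_below x.
by case: #|T| => //= n _; rewrite eqxx.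
Qed.

Lemma moebius_lt (x y : T) : (x < y)%O ->
  moebius x y = - \sum_(z : T | (x <= z < y)%O) moebius x z.
Proof.
move=> xy; rewrite /moebius.
rewrite (@moebius_fuel_stable #|T| #|T|.+1) ?ltnS ?(ltnW (card_below _)) //;
  last exact: card_below.
by rewrite [LHS]/= lt_eqF // xy.
Qed.

End Moebius.

Section GradedDiagram.
Variables (K : fieldType) (m : nat) (M : pmodule K 'I_m.+1).

Lemma ho_lt (x : hoint 'I_m.+2) : (ho_lo x < ho_hi x)%N.
Proof. exact: (ho_pairP x). Qed.

Lemma ho_fst_lt (x : hoint 'I_m.+2) : (ho_lo x < m.+1)%N.
Proof. by apply: leq_trans (ho_lt x) _; rewrite -ltnS. Qed.

Lemma ho_pred_snd_lt (x : hoint 'I_m.+2) : ((ho_hi x).-1 < m.+1)%N.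
Proof.
by have := ltn_ord (ho_hi x); have := ho_lt x; case: (nat_of_ord (ho_hi x)).
Qed.

Lemma ho_fst_le_pred_snd (x : hoint 'I_m.+2) :
  (Ordinal (ho_fst_lt x) <= Ordinal (ho_pred_snd_lt x))%O.
Proof. by rewrite leEord /=; have := ho_lt x; case: (nat_of_ord (ho_hi x)). Qed.

Definition rank_fun (k : nat) (x : hoint 'I_m.+2) : int :=
  if (k <= \dim (limg (pm_map M (ho_fst_le_pred_snd x))))%N then 1 else 0.

Definition graded_pd (k : nat) (x : hoint 'I_m.+2) : int :=
  \sum_(x' : hoint 'I_m.+2 | (x <= x')%O) moebius x x' * rank_fun k x'.

Definition bar_graded_pd (R : realType) (iota : embedding R m) (k : nat)
    (z : hoint R) : int :=
  if [pick x : hoint 'I_m.+2 |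
        (iota (ho_lo x) == ho_lo z) && (iota (ho_hi x) == ho_hi z)] is Some x
  then graded_pd k x else 0.

End GradedDiagram.

Definition is_graded_pd (K : fieldType) (R : realType) (k : nat)
    (N : pmodule K R) (D : hoint R -> int) : Prop :=
  exists (m : nat) (M : pmodule K 'I_m.+1) (iota : embedding R m),
    pm_iso N (bar M iota) /\ D = bar_graded_pd M iota k.

Section Wasserstein.
Variable R : realType.
Implicit Types p q : \bar R.

(* The points of R^2_< together with those of the diagonal. *)
Record upper := Upper {
  up_pair :> R * R;
  up_pairP : up_pair.1 <= up_pair.2
}.
HB.instance Definition _ := [isSub for up_pair].
HB.instance Definition _ := [Choice of upper by <:].

Definition on_diag (w : upper) : Prop := w.1 = w.2.

Definition upt (z : hoint R) : upper := Upper (ltW (ho_pairP z)).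

(* The [finite_set] conjunct is implied by the others when D and E are
   finitely supported and sums are read literally; it is needed here because
   [\sum_(w \in A)] is 0 on families with infinite support. *)
Definition coupling (D E : hoint R -> nat) (g : upper -> upper -> nat) : Prop :=
  [/\ finite_set [set zw : upper * upper | g zw.1 zw.2 != 0%N],
      forall z w, on_diag z -> on_diag w -> g z w = 0%N,
      forall z : hoint R, D z = \sum_(w \in [set: upper]) g (upt z) w &
      forall w : hoint R, E w = \sum_(z \in [set: upper]) g z (upt w)].

(* Meant for 1 <= p only. *)
Definition pnorm p (s : seq R) : R :=
  match p with
  | r%:E => (\sum_(x <- s) `|x| `^ r) `^ r^-1
  | +oo%E => \big[Num.max/0]_(x <- s) `|x|
  | -oo%E => 0
  end.

Definition qdist q (z w : upper) : R :=
  pnorm q [:: w.1 - z.1; w.2 - z.2].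

Definition cost_vector q (g : upper -> upper -> nat) : seq R :=
  flatten [seq nseq (g zw.1 zw.2) (qdist q zw.1 zw.2)
          | zw <- fset_set [set zw : upper * upper | g zw.1 zw.2 != 0%N]].

Definition cost p q (g : upper -> upper -> nat) : R := pnorm p (cost_vector q g).

Definition wasserstein_nat p q (D E : hoint R -> nat) : \bar R :=
  ereal_inf [set (cost p q g)%:E | g in coupling D E].

Definition pos_part (A : hoint R -> int) (z : hoint R) : nat :=
  absz (Num.max (A z) 0).
Definition neg_part (A : hoint R -> int) (z : hoint R) : nat :=
  absz (Num.max (- A z) 0).

Definition wasserstein p q (A B : hoint R -> int) : \bar R :=
  wasserstein_nat p q (fun z => pos_part A z + neg_part B z)%N
                      (fun z => pos_part B z + neg_part A z)%N.

End Wasserstein.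

(* Main.v *)
Require Import Defs.
From mathcomp Require Import all_boot all_order all_algebra.
From mathcomp Require Import finmap.
From mathcomp Require Import all_classical all_reals.
From mathcomp Require Import ereal exp.
From mathcomp Require Import zify ring lra.

(** For p > 1 a displacement is cheaper when it is split between several
    points: moving one point by 2 costs 2, whereas moving two points by 1 each
    costs only [pnorm p [:: 1; 1]] = 2^(1/p) < 2 (or 1 when p is infinite).  A
    signed diagram can supply the extra point.  If E has a negative point c,
    then comparing D with E adds c to the points of D, and c can serve as a
    relay: the point u of D stops halfway, while c goes the rest of the way.

    Let s = [pnorm p [:: 1; 1]] and eps = (2 - s) / 2, which is positive, and
    consider the points
        u = [-eps, 4),  e = [-eps, 5),  c = [0, 5),  v = [0, 6)
    and the diagrams D = u, E = e + v - c, F = v.  All three are k-th graded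
    diagrams; in particular c is the intersection of e and v, and this is why
    it occurs in E with coefficient -1.  Then
    - W(D, E) = W(u + c, e + v) <= s, through u -> e and c -> v, both of
      length 1;
    - W(E, F) = W(e + v, v + c) <= eps, through v -> v and e -> c;
    - W(D, F) = W(u, v) >= 2, because v and every point of the diagonal are at
      distance at least 2 from u.
    Since s + eps < 2, the triangle inequality fails.  The paired points of the
    first two matchings differ in a single coordinate, so that the value of q
    has no influence on the bounds.

    The diagrams are realised in a uniform way by a chain of copies of
    K^(k+1) in which the i-th step erases the i-th coordinate
    ([erasing_module]).  A composite of j of the first k + 1 steps has rank
    k + 1 - j, which is at least k exactly when j <= 1.  With one space, the diagram is a single
    interval; with three spaces, ranks at least k occur exactly below the
    intervals [0, 2) and [1, 3) of {0, 1, 2, 3}, and Moebius inversion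
    ([moebius_inversion]) gives [0, 2) + [1, 3) - [1, 2).

    Upper bounds on the distance come from explicit matchings
    ([wasserstein_nat_le]), and the lower bound from the fact that a single pair
    already bounds the cost of a coupling ([wasserstein_nat_ge]). *)

Set Implicit Arguments.
Unset Strict Implicit.
Unset Printing Implicit Defensive.

Import Order.TTheory GRing.Theory Num.Theory.

Local Open Scope classical_set_scope.
Local Open Scope ring_scope.

(** * Moebius inversion *)

Section MoebiusInversion.
Variables (d : Order.disp_t) (T : finPOrderType d).

(** The defining recursion of the Moebius function says that these sums vanish
    for x < y. *)
Lemma sum_moebius (x y : T) : (x <= y)%O ->
  \sum_(z : T | (x <= z <= y)%O) moebius x z = (x == y)%:R.
Proof.
move=> xy; rewrite (bigD1 y) ?xy ?lexx //=.
under eq_bigl => z do rewrite -andbA [X in _ && X]andbC -lt_neqAle.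
case: eqVneq => [->|nxy].
  rewrite moebius_id big1 ?addr0 // => z /andP[yz zy].
  by have := le_lt_trans yz zy; rewrite ltxx.
by rewrite moebius_lt ?addNr // lt_neqAle nxy.
Qed.

Lemma moebius_inversion (f g : T -> int) :
  (forall x, g x = \sum_(y : T | (x <= y)%O) f y) ->
  forall x, \sum_(y : T | (x <= y)%O) moebius x y * g y = f x.
Proof.
move=> gE x; under eq_bigr => y _ do rewrite gE mulr_sumr.
rewrite (exchange_big_dep (fun z => x <= z)%O) /=; last by move=> y z; apply: le_trans.
under eq_bigr => z xz do rewrite -mulr_suml sum_moebius //.
rewrite (bigD1 x) //= eqxx mul1r big1 ?addr0 // => z /andP[_ zx].
by rewrite eq_sym (negbTE zx) mul0r.
Qed.
End MoebiusInversion.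

(** * Modules that erase one coordinate at each step *)

Lemma pm_iso_refl (K : fieldType) (d : Order.disp_t) (P : porderType d)
  (M : pmodule K P) : pm_iso M M.
Proof.
exists (fun=> \1%VF), (fun=> \1%VF).
by split=> *; rewrite ?comp_lfun1l ?comp_lfun1r.
Qed.

Section Erasing.
Variables (K : fieldType) (n : nat).

Definition erase (a b : nat) : 'Hom('rV[K]_n, 'rV[K]_n) :=
  linfun (mulmxr (diag_mx (\row_j (~~ (a <= j < b)%N)%:R))).

Lemma eraseE a b v : erase a b v = \row_j ((~~ (a <= j < b)%N)%:R * v 0 j).
Proof.
by rewrite lfunE /= mul_mx_diag; apply/matrixP => i j; rewrite !mxE mulrC ord1.
Qed.

Lemma erase_id a : erase a a = \1%VF.
Proof.
apply/lfunP => v; rewrite eraseE lfunE; apply/rowP => j; rewrite !mxE.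
have -> : (a <= j < a)%N = false by lia.
by rewrite mul1r.
Qed.

Lemma erase_comp a b c : (a <= b)%N -> (b <= c)%N ->
  (erase b c \o erase a b)%VF = erase a c.
Proof.
move=> ab bc; apply/lfunP => v; rewrite lfunE /= !eraseE; apply/rowP => j.
rewrite !mxE mulrA -natrM mulnb -negb_or.
by have -> : (b <= j < c)%N || (a <= j < b)%N = (a <= j < c)%N by lia.
Qed.

Lemma erase_rank_nullity a b :
  (\dim (lker (erase a b)) + \dim (limg (erase a b)) = n)%N.
Proof.
by have := limg_ker_dim (erase a b) fullv; rewrite capfv dimvf /dim /= mul1n.
Qed.

(** The kernel is the line of the a-th basis vector, or zero when a >= n. *)
Lemma dim_erase_step a : (n <= (\dim (limg (erase a a.+1))).+1)%N.
Proof.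
have [na|an] := leqP n a.
  suff -> : erase a a.+1 = \1%VF by rewrite lim1g dimvf /dim /= mul1n.
  apply/lfunP => v; rewrite eraseE lfunE; apply/rowP => j; rewrite !mxE.
  have -> : (a <= j < a.+1)%N = false by have := ltn_ord j; lia.
  by rewrite mul1r.
suff : (\dim (lker (erase a a.+1)) <= 1)%N by have := erase_rank_nullity a a.+1; lia.
apply: (@leq_trans (\dim <[delta_mx 0 (Ordinal an) : 'rV[K]_n]>)); last first.
  by rewrite dim_vline leq_b1.
apply/dimvS/subvP => v; rewrite memv_ker eraseE => /eqP v0.
apply/vlineP; exists (v 0 (Ordinal an)); apply/rowP => j; rewrite !mxE eqxx /=.
have := congr1 (fun w : 'rV_n => w 0 j) v0; rewrite !mxE.
have -> : (a <= j < a.+1)%N = (j == Ordinal an) by rewrite -val_eqE /=; lia.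
by case: eqP => [->|_] /=; rewrite ?mulr1 ?mul1r ?mulr0.
Qed.

(** The kernel contains the basis vectors of indices a and a + 1; the upper
    bound on b ensures that both exist. *)
Lemma dim_erase_ge2 a b : (a.+1 < b <= n)%N ->
  ((\dim (limg (erase a b))).+1 < n)%N.
Proof.
move=> /andP[ab bn].
have an : (a < n)%N by lia.
have a1n : (a.+1 < n)%N by lia.
suff : (2 <= \dim (lker (erase a b)))%N by have := erase_rank_nullity a b; lia.
pose X := [:: delta_mx 0 (Ordinal an) : 'rV[K]_n; delta_mx 0 (Ordinal a1n)].
have : free X.
  rewrite free_cons span_seq1 seq1_free; apply/andP; split.
    apply/negP => /vlineP[c] /rowP /(_ (Ordinal an)); rewrite !mxE !eqxx /=.
    have -> : (Ordinal an == Ordinal a1n) = false by apply/negP => /eqP[]; lia.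
    by rewrite mulr0 => /eqP; rewrite oner_eq0.
  apply/negP => /eqP /rowP /(_ (Ordinal a1n)); rewrite !mxE !eqxx /= => /eqP.
  by rewrite oner_eq0.
rewrite /free => /eqP /= <-; apply/dimvS/span_subvP => v.
have ker j : (a <= val j < b)%N -> delta_mx 0 j \in lker (erase a b).
  move=> abj; rewrite memv_ker eraseE; apply/eqP/rowP => i; rewrite !mxE eqxx /=.
  by case: eqP => [->|_] /=; rewrite ?abj ?mul0r ?mulr0.
by rewrite !inE => /orP[]/eqP->; apply: ker => /=; lia.
Qed.
End Erasing.

Section ErasingModule.
Variables (K : fieldType) (k m : nat).

Definition erasing_module : pmodule K 'I_m.+1.
Proof.
refine (@PModule K _ 'I_m.+1 (fun=> 'rV[K]_k.+1)
  (fun a b _ => erase K k.+1 a b) _ _).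
- by move=> a _; apply: erase_id.
- by move=> a b c ab bc _; apply: erase_comp.
Defined.

(** The interval [x, y) carries the map from x to y - 1, which consists of
    y - 1 - x steps, and the rank stays at least k for at most one step. *)
Lemma rank_fun_erasing (x : hoint 'I_m.+2) : (m <= k.+1)%N ->
  rank_fun erasing_module k x = (ho_hi x <= (ho_lo x).+2)%N%:R.
Proof.
move=> mk; rewrite /rank_fun /=; have := ho_lt x.
move: (ltn_ord (ho_hi x)); move: (nat_of_ord (ho_lo x)) (nat_of_ord (ho_hi x)).
move=> a [//|b] /= bm ab.
have [b2|b2] := leqP b.+1 a.+2.
  have [->|nab] := eqVneq a b.
    by rewrite erase_id lim1g dimvf /dim /= mul1n leqnSn.
  have -> : b = a.+1 by lia.
  by rewrite -ltnS dim_erase_step.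
by rewrite leqNgt -ltnS dim_erase_ge2 //; lia.
Qed.
End ErasingModule.

(** * Transport of diagrams along an embedding into the reals *)

Lemma ho_leE n (x y : hoint 'I_n) :
  (x <= y)%O = (ho_lo y <= ho_lo x)%N && (ho_hi x <= ho_hi y)%N.
Proof. by []. Qed.

Section Push.
Variables (R : realType) (m : nat) (iota : embedding R m).

Lemma embedding_lt (i j : 'I_m.+2) : (i < j)%O -> iota i < iota j.
Proof.
move=> ij; rewrite lt_neqAle (emb_le iota (ltW ij)) andbT.
by rewrite (inj_eq (@emb_inj _ _ iota)) lt_eqF.
Qed.

Definition ho_push (x : hoint 'I_m.+2) : hoint R :=
  @HoInt _ R (iota (ho_lo x), iota (ho_hi x)) (embedding_lt (ho_pairP x)).

Lemma ho_push_inj : injective ho_push.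
Proof.
move=> x y [/emb_inj lo /emb_inj hi]; apply: val_inj.
by rewrite [LHS]surjective_pairing [RHS]surjective_pairing; congr pair.
Qed.

(** As [ho_push] is injective, the sum has at most one term; in this form the
    diagram is visibly linear in the values of [graded_pd]. *)
Lemma bar_graded_pdE (K : fieldType) (M : pmodule K 'I_m.+1) k z :
  bar_graded_pd M iota k z = \sum_(x | z == ho_push x) graded_pd M k x.
Proof.
have pushE x : (iota (ho_lo x) == ho_lo z) && (iota (ho_hi x) == ho_hi z) =
    (z == ho_push x).
  rewrite [RHS]eq_sym -val_eqE; case: z => -[a b] ? /=.
  by rewrite /ho_lo /ho_hi /= xpair_eqE.
rewrite /bar_graded_pd; case: pickP => [x|none].
  rewrite pushE => /eqP zx; rewrite (bigD1 x) ?zx //= big1 ?addr0 // => y.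
  by rewrite (inj_eq ho_push_inj) eq_sym andbN.
by rewrite big1 // => x; rewrite -pushE none.
Qed.

Lemma sum_push1 (x : hoint 'I_m.+2) z :
  \sum_(y | z == ho_push y) (y == x)%:R = (z == ho_push x)%:R :> int.
Proof.
rewrite big_mkcond (bigD1 x) //= eqxx big1 ?addr0; first by case: ifP.
by move=> y /negbTE->; rewrite if_same.
Qed.
End Push.

Section SortedEmbedding.
Variables (R : realType) (m : nat) (s : seq R).
Hypotheses (size_s : size s = m.+2) (sorted_s : sorted <%R s).

Definition seq_embedding : embedding R m.
Proof.
refine (@Embedding R m (fun i => s`_i) _ _) => i j.
  by move/eqP; rewrite nth_uniq ?size_s ?lt_sorted_uniq // => /eqP/val_inj.
apply: (sorted_leq_nth le_trans lexx 0 (sub_sorted (@ltW _ R) sorted_s));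
  by rewrite ?inE ?size_s ?ltn_ord.
Defined.
End SortedEmbedding.

(** * Norms of short vectors *)

Section PNorm.
Variables (R : realType) (p : \bar R).

Lemma perm_pnorm (s t : seq R) : perm_eq s t -> pnorm p s = pnorm p t.
Proof. by move=> st; rewrite /pnorm; case: p => [r||] //; rewrite (perm_big _ st). Qed.

Hypothesis p1 : (1 <= p)%E.

Lemma pnorm0r (x : R) : pnorm p [:: 0; x] = `|x|.
Proof.
rewrite /pnorm; case: p p1 => [r||] //; last first.
  by rewrite !big_cons big_nil normr0 [X in Num.max _ X]max_l ?max_r.
rewrite lee_fin => r1; have r0 : r != 0 by rewrite gt_eqF // (lt_le_trans ltr01).
by rewrite !big_cons big_nil normr0 powR0 // add0r addr0 -powRrM mulfV // powRr1.
Qed.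

Lemma le_pnorm (s : seq R) (x : R) : x \in s -> `|x| <= pnorm p s.
Proof.
move=> xs; rewrite /pnorm; case: p p1 => [r||] //; last first.
  by move=> _; apply: (@Order.TotalTheory.le_bigmax_seq _ _ _ _ 0 x xpredT Num.norm).
rewrite lee_fin => r1; have r0 : 0 < r by apply: lt_le_trans r1.
have -> : `|x| = (`|x| `^ r) `^ r^-1.
  by rewrite -powRrM mulfV ?powRr1 // gt_eqF.
apply: ge0_ler_powR; rewrite ?nnegrE ?powR_ge0 ?invr_ge0 ?(ltW r0) //.
  by apply: sumr_ge0 => y _; apply: powR_ge0.
rewrite (big_rem x) //= lerDl; apply: sumr_ge0 => y _; apply: powR_ge0.
Qed.

End PNorm.

Lemma pnorm11_lt2 (R : realType) (p : \bar R) : (1 < p)%E -> pnorm p [:: 1; 1] < 2.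
Proof.
case: p => [r||] //; last first.
  by rewrite /pnorm !big_cons big_nil normr1 !maxEle; do 2?case: ifP => _; rewrite ?ltr1n.
rewrite lte_fin /= => r1; rewrite !big_cons big_nil normr1 powR1 addr0.
have r0 : 0 < r by apply: lt_trans r1.
rewrite -[ltRHS](@powRr1 R) //; rewrite /powR.
have -> : (1 + 1 : R) = 2 by ring.
rewrite pnatr_eq0 /= ltr_expR ltr_pM2r ?ln_gt0 ?ltr1n //.
by rewrite invf_lt1.
Qed.

(** * Bounds on the Wasserstein distance *)

Section Coupling.
Variable R : realType.
Implicit Types (p q : \bar R) (s : seq (hoint R * hoint R)).

Lemma upt_inj : injective (@upt R).
Proof. by move=> x y [xy]; apply: val_inj. Qed.

Lemma upt_not_diag (z : hoint R) : ~ on_diag (upt z).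
Proof. by case: z => -[a b] /= ab; rewrite /on_diag /= => ba; rewrite ba ltxx in ab. Qed.

Lemma upt_surj (w : upper R) : ~ on_diag w -> exists z, w = upt z.
Proof.
case: w => -[a b] /= ab nd.
have lt : a < b by rewrite lt_neqAle ab andbT; apply/eqP => e; apply: nd.
by exists (@HoInt _ R (a, b) lt); apply: val_inj.
Qed.

Lemma fsum_count_pair (T : choiceType) (s : seq (T * T)) z :
  \sum_(w \in [set: T]) count_mem (z, w) s = count_mem z (unzip1 s).
Proof.
rewrite (fsbigTE [fset w | w in unzip2 s]%fset); last first.
  move=> w; rewrite inE => ws; apply/count_memPn; apply: contra ws.
  by move/(map_f snd).
rewrite count_map -sum1_count.
under eq_bigr => w _ do rewrite -sum1_count big_mkcond.
rewrite [LHS]exchange_big [RHS]big_mkcond [LHS]big_seq [RHS]big_seq /=.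
apply: eq_bigr => -[a b] abs; rewrite (bigD1_seq b) ?fset_uniq //=; last first.
  by rewrite inE; apply: (map_f snd abs).
rewrite xpair_eqE eqxx andbT big1 ?addr0 // => w wb.
by rewrite xpair_eqE [b == w]eq_sym (negbTE wb) andbF.
Qed.

Lemma count_mem_swap (T : eqType) (s : seq (T * T)) z w :
  count_mem (z, w) s = count_mem (w, z) [seq (x.2, x.1) | x <- s].
Proof. by rewrite count_map; apply: eq_count => -[a b] /=; rewrite !xpair_eqE andbC. Qed.

Definition pair_up s := [seq (upt x.1, upt x.2) | x <- s].
Definition list_coupling s (z w : upper R) : nat := count_mem (z, w) (pair_up s).

Lemma list_coupling_supp s :
  [set zw | list_coupling s zw.1 zw.2 != 0%N] = [set` pair_up s].
Proof.
apply/seteqP; split=> -[z w]; rewrite /list_coupling /=;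
  by rewrite -lt0n -has_count has_pred1.
Qed.

(** Counting occurrences makes the list itself the multiset of pairs, so
    repeated pairs need no separate treatment. *)
Lemma list_couplingP s :
  coupling (fun z => count_mem z (unzip1 s)) (fun w => count_mem w (unzip2 s))
    (list_coupling s).
Proof.
split=> [|z w dz _|z|w].
- by rewrite list_coupling_supp; apply: finite_seq.
- apply/count_memPn/mapP => -[x _ [zx _]]; apply: (@upt_not_diag x.1).
  by rewrite -zx.
- rewrite /list_coupling fsum_count_pair /unzip1 /pair_up -map_comp !count_map.
  by apply: eq_count => x /=; rewrite (inj_eq upt_inj).
- under eq_fsbigr => z _ do rewrite /list_coupling count_mem_swap.
  rewrite fsum_count_pair /unzip1 /pair_up -!map_comp !count_map.
  by apply: eq_count => x /=; rewrite (inj_eq upt_inj).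
Qed.

(** The cost vector of [list_coupling s] lists the lengths of the pairs of [s]
    grouped by repeated pairs, and [pnorm] does not depend on the order. *)
Lemma wasserstein_nat_le p q s :
  (wasserstein_nat p q (fun z => count_mem z (unzip1 s))
     (fun w => count_mem w (unzip2 s)) <=
   (pnorm p [seq qdist q (upt x.1) (upt x.2) | x <- s])%:E)%E.
Proof.
apply: ereal_inf_lbound; exists (list_coupling s); first exact: list_couplingP.
congr _%:E; apply: perm_pnorm; rewrite /cost_vector list_coupling_supp.
rewrite (_ : [seq _ | x <- s] = [seq qdist q zw.1 zw.2 | zw <- pair_up s]); last first.
  by rewrite /pair_up -map_comp.
rewrite perm_sym; apply: perm_trans (perm_map _ _) _.
  by rewrite perm_sym; apply: perm_count_undup.
rewrite map_flatten -map_comp.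
apply: perm_trans (perm_flatten (perm_map _ _)) _.
  apply: uniq_perm (undup_uniq _) (fset_uniq (fset_set [set` pair_up s])) _ => x.
  by rewrite mem_undup in_fset_set ?mem_setE //; apply: finite_seq.
apply/permP => P; congr (count P (flatten _)); apply: eq_map => -[z w] /=.
by rewrite map_nseq.
Qed.

(** A coupling has to match u with some w, which is diagonal or in the support
    of E, and the entry of the pair (u, w) is at most the norm of the cost
    vector. *)
Lemma wasserstein_nat_ge p q (D E : hoint R -> nat) (u : hoint R) (c : R) :
  (1 <= p)%E -> D u != 0%N ->
  (forall w, on_diag w -> c <= qdist q (upt u) w) ->
  (forall w : hoint R, E w != 0%N -> c <= qdist q (upt u) (upt w)) ->
  (c%:E <= wasserstein_nat p q D E)%E.
Proof.
move=> p1 Du cdiag cE; apply: le_ereal_inf_tmp => _ [g [fin gd gD gE] <-].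
rewrite lee_fin.
have [w _ gw] : exists2 w, [set: upper R] w & g (upt u) w != 0%N.
  by apply: (@fsbigN1 _ 0%N addn _ _ setT g (upt u)); rewrite -gD.
have cw : c <= qdist q (upt u) w.
  have [dw|/upt_surj[v wE]] := pselect (on_diag w); first exact: cdiag.
  rewrite wE in gw *; apply: cE; apply: contra_neq (gw); rewrite gE.
  rewrite (fsbigTE [fset zw.1 | zw in fset_set [set zw | g zw.1 zw.2 != 0%N]]%fset).
    rewrite (big_rem (upt u)) /=; last first.
      by apply/imfsetP; exists (upt u, upt v) => //=; rewrite in_fset_set // inE.
    by move/eqP; rewrite addn_eq0 => /andP[/eqP].
  move=> z zA; apply/eqP; apply: contraNT zA => gz.
  by apply/imfsetP; exists (z, upt v) => //=; rewrite in_fset_set // inE.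
apply: le_trans cw (le_trans (ler_norm _) _); apply: le_pnorm => //; apply/flatten_mapP.
exists (upt u, w); first by rewrite in_fset_set // inE.
by rewrite mem_nseq lt0n gw eqxx.
Qed.

End Coupling.

Lemma le_qdist (R : realType) (q : \bar R) (z w : upper R) (q1 : (1 <= q)%E) :
  (w.1 - z.1 <= qdist q z w) /\ (`|w.2 - z.2| <= qdist q z w).
Proof.
split; last by apply: le_pnorm => //; rewrite !inE eqxx orbT.
by apply: le_trans (ler_norm _) _; apply: le_pnorm => //; rewrite !inE eqxx.
Qed.

Lemma absz_max_sub0 (m n : nat) : minn m n = 0%N ->
  absz (Num.max (m%:R - n%:R : int) 0) = m.
Proof.
rewrite !natz; case: n => [|n]; first by rewrite subr0 max_l.
by case: m => [|m]; [rewrite sub0r max_r|rewrite minnSS].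
Qed.

(** Functions a and b with disjoint supports are necessarily the positive and
    negative parts of a - b. *)
Lemma wasserstein_signed (R : realType) (p q : \bar R) (A B : hoint R -> int)
    (a b a' b' : hoint R -> nat) :
  (forall z, A z = (a z)%:R - (b z)%:R) -> (forall z, minn (a z) (b z) = 0%N) ->
  (forall z, B z = (a' z)%:R - (b' z)%:R) -> (forall z, minn (a' z) (b' z) = 0%N) ->
  wasserstein p q A B =
  wasserstein_nat p q (fun z => a z + b' z)%N (fun z => a' z + b z)%N.
Proof.
move=> AE ab BE ab'; rewrite /wasserstein /pos_part /neg_part.
congr wasserstein_nat; apply/funext => z; rewrite AE BE opprB.
  by rewrite !absz_max_sub0 // minnC.
by rewrite !absz_max_sub0 // minnC.
Qed.

(** * The diagrams of the erasing modules *)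

Section DiscreteDiagrams.
Variables (K : fieldType) (k : nat).

Definition nat_hoint m (a b : nat) (ab : (a < b)%N) (bm : (b < m.+2)%N) : hoint 'I_m.+2 :=
  @HoInt _ 'I_m.+2 (Ordinal (ltn_trans ab bm), Ordinal bm) ab.

Lemma sum_indicator_ge (d : Order.disp_t) (T : finPOrderType d) (x y : T) :
  \sum_(z : T | (x <= z)%O) (z == y)%:R = (x <= y)%O%:R :> int.
Proof.
rewrite big_mkcond (bigD1 y) //= eqxx big1 ?addr0; first by case: ifP.
by move=> z /negbTE->; rewrite if_same.
Qed.

Lemma graded_pd_erasing0 (x : hoint 'I_2) :
  graded_pd (erasing_module K k 0) k x = (x == nat_hoint (ltn0Sn 0) (ltnSn 1))%:R.
Proof.
rewrite /graded_pd; apply: (@moebius_inversion _ _ (fun y => (y == _)%:R)) => {}x.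
rewrite sum_indicator_ge rank_fun_erasing // ho_leE /=; congr (nat_of_bool _)%:R.
have := ltn_ord (ho_hi x); have := ho_lt x.
by move: (nat_of_ord (ho_lo x)) (nat_of_ord (ho_hi x)) => a b; lia.
Qed.

(** The intervals below [0, 2) and those below [1, 3) overlap in the intervals
    below [1, 2), and the negative term compensates for counting them twice. *)
Lemma graded_pd_erasing2 (x : hoint 'I_4) : (1 <= k)%N ->
  graded_pd (erasing_module K k 2) k x =
    (x == @nat_hoint 2 0 2 isT isT)%:R + (x == @nat_hoint 2 1 3 isT isT)%:R
    - (x == @nat_hoint 2 1 2 isT isT)%:R.
Proof.
move=> k1; rewrite /graded_pd.
apply: (@moebius_inversion _ _ (fun y => (y == _)%:R + (y == _)%:R - (y == _)%:R)) => {}x.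
rewrite sumrB big_split /= !sum_indicator_ge rank_fun_erasing // !ho_leE /=.
have := ltn_ord (ho_hi x); have := ho_lt x.
move: (nat_of_ord (ho_lo x)) (nat_of_ord (ho_hi x)) => a b ab b4.
by do 4?[case: b ab b4 => [|b] ab b4 //]; do 3?[case: a ab => [|a] ab //].
Qed.
End DiscreteDiagrams.

(** * Failure of the triangle inequality *)

Theorem proposition6p7 (K : fieldType) (R : realType) (p q : \bar R) (k : nat)
    (hp : (1 < p)%E) (hq : (1 <= q)%E) (hk : (1 <= k)%N) :
  exists (L M N : pmodule K R) (D E F : hoint R -> int),
    [/\ tame L, tame M & tame N] /\
    [/\ is_graded_pd k L D, is_graded_pd k M E & is_graded_pd k N F] /\
    (wasserstein p q D E + wasserstein p q E F < wasserstein p q D F)%E.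
Proof.
have s2 := pnorm11_lt2 hp; set s := pnorm p _ in s2.
pose eps := (2 - s) / 2; have eps0 : 0 < eps by rewrite divr_gt0 ?subr_gt0.
have sortD : sorted <%R [:: - eps; 4 : R] by rewrite /=; lra.
have sortE : sorted <%R [:: - eps; 0; 5; 6 : R] by rewrite /=; lra.
have sortF : sorted <%R [:: 0; 6 : R] by rewrite /=; lra.
pose iD := @seq_embedding R 0 [:: - eps; 4] erefl sortD.
pose iE := @seq_embedding R 2 [:: - eps; 0; 5; 6] erefl sortE.
pose iF := @seq_embedding R 0 [:: 0; 6] erefl sortF.
pose u := ho_push iD (@nat_hoint 0 0 1 isT isT).
pose e := ho_push iE (@nat_hoint 2 0 2 isT isT).
pose c := ho_push iE (@nat_hoint 2 1 2 isT isT).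
pose v := ho_push iE (@nat_hoint 2 1 3 isT isT).
(* v is an interval of both E and F, which use different embeddings. *)
have vF : v = ho_push iF (@nat_hoint 0 0 1 isT isT) by apply: val_inj.
pose M0 := erasing_module K k 0; pose M2 := erasing_module K k 2.
exists (bar M0 iD), (bar M2 iE), (bar M0 iF).
exists (bar_graded_pd M0 iD k), (bar_graded_pd M2 iE k), (bar_graded_pd M0 iF k).
split.
  by split; [exists 0%N, M0, iD|exists 2%N, M2, iE|exists 0%N, M0, iF];
    apply: pm_iso_refl.
split.
  by split; [exists 0%N, M0, iD|exists 2%N, M2, iE|exists 0%N, M0, iF];
    split=> //; apply: pm_iso_refl.
have DE z : bar_graded_pd M0 iD k z = (z == u)%:R - 0%:R.
  rewrite bar_graded_pdE; under eq_bigr do rewrite graded_pd_erasing0.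
  by rewrite sum_push1 subr0; congr (z == _)%:R; apply: val_inj.
have EE z : bar_graded_pd M2 iE k z = ((z == e) + (z == v))%N%:R - (z == c)%:R.
  rewrite bar_graded_pdE; under eq_bigr do rewrite graded_pd_erasing2 //.
  by rewrite sumrB big_split /= !sum_push1 natrD.
have FE z : bar_graded_pd M0 iF k z = (z == v)%:R - 0%:R.
  rewrite bar_graded_pdE; under eq_bigr do rewrite graded_pd_erasing0.
  by rewrite sum_push1 subr0 vF; congr (z == _)%:R; apply: val_inj.
have minE z : minn ((z == e) + (z == v))%N (z == c) = 0%N.
  have [->|] := eqVneq z c; last by rewrite minn0.
  by rewrite !(inj_eq (@ho_push_inj _ _ _)).
have step1 : (wasserstein p q (bar_graded_pd M0 iD k) (bar_graded_pd M2 iE k) <= s%:E)%E.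
  rewrite (wasserstein_signed p q DE _ EE minE); last by move=> z; rewrite minn0.
  have := wasserstein_nat_le p q [:: (u, e); (c, v)].
  rewrite /= /qdist /= ?subrr.
  have -> : 5 - 4 = 1 :> R by ring.
  have -> : 6 - 5 = 1 :> R by ring.
  rewrite !pnorm0r // normr1; congr (wasserstein_nat _ _ _ _ <= _)%E;
   by apply/funext => z; rewrite ?addn0 ![_ == z]eq_sym.
have step2 : (wasserstein p q (bar_graded_pd M2 iE k) (bar_graded_pd M0 iF k) <= eps%:E)%E.
  rewrite (wasserstein_signed p q EE minE FE); last by move=> z; rewrite minn0.
  have := wasserstein_nat_le p q [:: (v, v); (e, c)].
  rewrite /= /qdist /= ?subrr opprK add0r (@perm_pnorm _ q [:: eps; 0] [:: 0; eps]).
    rewrite !pnorm0r ?(ltW hp) // normr0 pnorm0r ?(ltW hp) // normr_id (gtr0_norm eps0).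
    congr (wasserstein_nat _ _ _ _ <= _)%E;
    by apply/funext => z; rewrite ?addn0 ![_ == z]eq_sym // addnC.
  by rewrite (perm_catC [:: eps] [:: 0]).
have direct : (2%:E <= wasserstein p q (bar_graded_pd M0 iD k) (bar_graded_pd M0 iF k))%E.
  rewrite (wasserstein_signed p q DE _ FE); last first.
    by move=> z; rewrite minn0.
    by move=> z; rewrite minn0.
  apply: (@wasserstein_nat_ge _ p q _ _ u); first exact: ltW.
  - by rewrite eqxx.
  - (* If w = (t, t), then t + eps >= 2 or 4 - t >= 2, according to whether
       t >= 2. *)
    move=> w dw; have [] := le_qdist (upt u) w hq; rewrite -dw /=.
    have := ler_norm (4 - w.1); rewrite distrC.
    by case: (lerP 2 w.1); lra.
  - move=> w; have [->|//] := eqVneq w v => _.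
    have [_ /=] := le_qdist (upt u) (upt v) hq; apply: le_trans.
    by apply: le_trans (ler_norm _); lra.
apply: lt_le_trans direct; apply: le_lt_trans (leeD step1 step2) _.
by rewrite -EFinD lte_fin /eps; lra.
Qed.
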